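(* For every graph $H$, every integer $r \geq 300\,v(H)^9$, every positive integer $n$, and every $n$-vertex graph $G$ containing no $K_{r+1}$ as a subgraph, we have $\mathrm{inj}(H,G) \leq \mathrm{inj}(H,T_r(n))$.
   Context: $v(H)$ denotes the number of vertices of $H$. A map $\varphi:V(H)\to V(G)$ is a homomorphism from $H$ to $G$ if $\varphi(u)\varphi(v)\in E(G)$ for every $uv\in E(H)$. $\mathrm{inj}(H,G)$ denotes the number of injective homomorphisms from $H$ to $G$. $T_r(n)$ is the complete $r$-partite graph on $n$ vertices whose parts have sizes $\lfloor n/r\rfloor$ or $\lceil n/r\rceil$ (so $T_r(n)=K_n$ if $n\le r$). *)

(* Defs.v *)
From mathcomp Require Import all_boot all_order.
Set Implicit Arguments. Unset Strict Implicit. Unset Printing Implicit Defensive.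

Definition simple_graph (T : finType) (e : rel T) : Prop :=
  irreflexive e /\ symmetric e.

Definition inj_hom (T U : finType) (eH : rel T) (eG : rel U) : nat :=
  #|[set f : {ffun T -> U} | injectiveb f &&
      [forall x, forall y, eH x y ==> eG (f x) (f y)]]|.

Definition Kfree (U : finType) (e : rel U) (k : nat) : Prop :=
  ~ exists S : {set U}, #|S| = k /\ {in S &, forall x y, x != y -> e x y}.

(* Turán graph T_r(n) on vertex set 'I_n: parts are the residue classes mod r,
   of sizes floor(n/r) or ceil(n/r); complete r-partite. (For n <= r it is K_n.) *)
Definition turan_rel (n r : nat) : rel 'I_n :=
  fun i j => (i %% r) != (j %% r).
Arguments turan_rel n r : clear implicits.

(* Main.v *)
Require Import Defs.
From mathcomp Require Import all_boot perm zify.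

(* Write [pull e rho] for the graph in which [a, b] are adjacent when [rho a],
   [rho b] are adjacent in [e]; for every [rho] it is again K_(r+1)-free. Take a
   graph [e] whose count of copies of H no pull-back increases. Replacing one
   vertex by a clone of another changes the count by the difference of the
   numbers of copies through them, up to copies through both, so all vertices
   lie on almost equally many copies. As [e] has at least as many copies as the
   Turan graph, every vertex has few non-neighbours, and then the number of
   copies through two given vertices depends, up to a small relative error, only
   on whether they are adjacent.

   If [u], [v] and [v], [w] are non-adjacent but [u], [w] are adjacent, one of
   the three graphs obtained by turning [v] into a clone of [u], [v] into a clone
   of [w], or [u] and [w] into clones of [v] has more copies. So [e] is complete
   multipartite. Among complete multipartite graphs the count is concave in the
   splitting of two classes, hence balancing them does not decrease it. *)

Set Implicit Arguments.
Unset Strict Implicit.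
Unset Printing Implicit Defensive.

(** * Counting injections with prescribed values *)

Section Injections.

Variables T U : finType.
Implicit Types (f g : {ffun T -> U}) (xs : seq T) (us : seq U).

Definition injections_at xs us : {set {ffun T -> U}} :=
  [set f : {ffun T -> U} | injectiveb f & map f xs == us].

Lemma injections_at_cons x u xs us f :
  (f \in injections_at (x :: xs) (u :: us)) =
  (f \in injections_at xs us) && (f x == u).
Proof. by rewrite !inE /= eqseq_cons -andbA [(f x == u) && _]andbC. Qed.

Definition perm_comp (p : {perm U}) f : {ffun T -> U} := [ffun x => p (f x)].

Lemma perm_comp_inj p : injective (perm_comp p).
Proof.
move=> f g /ffunP efg; apply/ffunP=> x.
by move: (efg x); rewrite !ffunE => /perm_inj.
Qed.

Lemma perm_comp_injectiveb p f : injectiveb (perm_comp p f) = injectiveb f.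
Proof.
apply/injectiveP/injectiveP => finj x y.
  by move=> efxy; apply: finj; rewrite !ffunE efxy.
by rewrite !ffunE => /perm_inj/finj.
Qed.

(** Composing with the transposition of [u] and [v] changes no value in [us], since neither vertex
    occurs there; applied in both directions this gives equality. *)
Lemma card_injections_at_le x u v xs us :
  u \notin us -> v \notin us ->
  #|injections_at (x :: xs) (u :: us)| <= #|injections_at (x :: xs) (v :: us)|.
Proof.
move=> uNus vNus.
rewrite -(card_imset _ (@perm_comp_inj (tperm u v))).
apply/subset_leq_card/subsetP => _ /imsetP[f + ->].
rewrite !inE perm_comp_injectiveb /= !eqseq_cons !ffunE.
case/andP=> -> /andP[/eqP-> /eqP fxs]; rewrite tpermL eqxx /=; apply/eqP.
rewrite -[RHS]map_id -fxs -map_comp; apply/eq_in_map => y yxs /=.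
have fyus : f y \in us by rewrite -fxs map_f.
rewrite ffunE tpermD //; first by apply: contraNneq uNus => ->.
by apply: contraNneq vNus => ->.
Qed.

(** Sort the injections on the right by their value at [x]: it avoids [us], and by symmetry all
    remaining values are equally frequent. *)
Lemma card_injections_at_cons x u xs us :
  x \notin xs -> u \notin us -> uniq us ->
  #|injections_at (x :: xs) (u :: us)| * (#|U| - size us) =
  #|injections_at xs us|.
Proof.
move=> xNxs uNus us_uniq.
have -> : #|U| - size us = #|[set v | v \notin us]|.
  rewrite -(card_uniqP us_uniq) -[in LHS](cardC (mem us)) addKn.
  by apply: eq_card => v; rewrite !inE.
rewrite -[in RHS]sum1_card.
rewrite (partition_big (fun f => f x) (mem [set v | v \notin us])) /=; last first.
  move=> f; rewrite !inE => /andP[/injectiveP finj /eqP <-].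
  by rewrite mem_map.
rewrite mulnC -sum_nat_const; apply: eq_bigr => v; rewrite inE => vNus.
rewrite sum1dep_card.
rewrite -[RHS](@eq_card _ (mem (injections_at (x :: xs) (v :: us)))); last first.
  by move=> f; rewrite injections_at_cons !inE.
by apply/eqP; rewrite eqn_leq !card_injections_at_le.
Qed.

Lemma card_injections_at xs us :
  uniq xs -> uniq us -> size xs = size us ->
  #|injections_at xs us| = (#|U| - size us) ^_ (#|T| - size us).
Proof.
elim: xs us => [|x xs IHxs] [|u us] //=.
  move=> _ _ _; rewrite !subn0 -card_inj_ffuns.
  by apply: eq_card => f; rewrite !inE andbT.
move=> /andP[xNxs xs_uniq] /andP[uNus us_uniq] [esz].
have uniq_size_card (V : finType) (s : seq V) : uniq s -> size s <= #|V|.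
  by move/card_uniqP <-; exact: max_card.
have usU : size us < #|U|.
  by apply: (uniq_size_card _ (u :: us)); rewrite /= uNus.
have xsT : size us < #|T|.
  by rewrite -esz; apply: (uniq_size_card _ (x :: xs)); rewrite /= xNxs.
have := card_injections_at_cons xNxs uNus us_uniq.
rewrite IHxs // -[#|T| - _]prednK ?subn_gt0 // ffactnS mulnC.
by move/eqP; rewrite eqn_pmul2l ?subn_gt0 // -!subnS => /eqP.
Qed.

Definition reassign f (b : T) (z : U) : {ffun T -> U} :=
  [ffun x => if x == b then z else f x].

(* Changing the value of [f] at [b] to an unused vertex shows that at most
   [D / (#|U| - #|T| + 1)] of all the injections map the pair [a, b] to a
   non-edge. *)
Lemma card_nonedge_injections (e : rel U) (D : nat) a b xs us :
  (forall v, #|[set w | (w != v) && ~~ e v w]| <= D) ->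
  a != b -> b \notin xs ->
  #|[set f in injections_at xs us | ~~ e (f a) (f b)]| * (#|U| - #|T|.-1) <=
  D * #|injections_at xs us|.
Proof.
move=> hD ab bxs.
pose unused f := [set z | z \notin f @: [set~ b]].
pose X := [set fz : {ffun T -> U} * U |
              (fz.1 \in injections_at xs us) && ~~ e (fz.1 a) (fz.1 b)
              & fz.2 \in unused fz.1].
pose Y := [set gw : {ffun T -> U} * U | gw.1 \in injections_at xs us
              & (gw.2 != gw.1 a) && ~~ e (gw.1 a) gw.2].
have cX : #|X| =
    #|[set f in injections_at xs us | ~~ e (f a) (f b)]| * (#|U| - #|T|.-1).
  transitivity (\sum_(f in injections_at xs us | ~~ e (f a) (f b))
                  \sum_(z in unused f) 1).
    by rewrite pair_big_dep sum1dep_card.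
  rewrite -sum_nat_const; apply: eq_big => [f|f /andP[]]; first by rewrite inE.
  rewrite inE => /andP[/injectiveP finj _ _]; rewrite sum1_card.
  rewrite -(cardsT U) -(cardsID (f @: [set~ b]) [set: U]) setTI card_imset //.
  rewrite cardsC1 addKn; apply: eq_card => z; rewrite !inE andbT //.
have cY : #|Y| <= D * #|injections_at xs us|.
  have -> : #|Y| = \sum_(g in injections_at xs us)
                     \sum_(w | (w != g a) && ~~ e (g a) w) 1.
    by rewrite pair_big_dep sum1dep_card.
  rewrite mulnC -sum_nat_const; apply: leq_sum => g _.
  rewrite sum1dep_card; exact: hD.
rewrite -cX; apply: leq_trans cY.
(* Recording the old value [f b], a non-neighbour of [f a], makes the reassignment reversible. *)
pose F (fz : {ffun T -> U} * U) := (reassign fz.1 b fz.2, fz.1 b).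
rewrite -(@card_in_imset _ _ F) => [|[f z] [f' z'] _ _ /= [/ffunP eff ebb]]; last first.
  congr pair; last by move: (eff b); rewrite !ffunE eqxx.
  apply/ffunP => x; move: (eff x); rewrite !ffunE.
  by case: eqP => [-> //|//].
apply/subset_leq_card/subsetP => _ /imsetP[[f z] + ->].
rewrite !inE /= => /andP[/andP[/andP[/injectiveP finj /eqP fxs] nfab] zf].
have zP y : y != b -> z != f y.
  by move=> yb; apply: contraNneq zf => ->; apply: imset_f; rewrite !inE.
rewrite !ffunE (negPf ab) nfab andbT (inj_eq finj) [b == a]eq_sym ab andbT.
apply/andP; split.
  apply/injectiveP => x y; rewrite !ffunE.
  case: (eqVneq x b) => [->|xb]; case: (eqVneq y b) => [->|yb] // exy.
  - by case/eqP: (zP _ yb).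
  - by case/eqP: (zP _ xb).
  - exact: finj.
apply/eqP; rewrite -fxs; apply/eq_in_map => y yxs; rewrite ffunE.
by case: eqP yxs bxs => // -> ->.
Qed.

End Injections.

(** * Homomorphisms through one, two or three given vertices *)

Section Homomorphisms.

Variables (T U : finType) (eH : rel T).
Hypotheses (eH_irr : irreflexive eH) (eH_sym : symmetric eH).
Implicit Types (f : {ffun T -> U}) (xs : seq T) (us ws : seq U) (e : rel U).

Let n := #|U|.
Let h := #|T|.

(** By [card_injections_at], the number of injections with [k] values prescribed. *)
Definition injection_count k := (n - k) ^_ (h - k).
Local Notation J := injection_count.

Definition homs e : {set {ffun T -> U}} :=
  [set f : {ffun T -> U} | injectiveb f &&
      [forall x, forall y, eH x y ==> e (f x) (f y)]].

Lemma homs_injective e f : f \in homs e -> injective f.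
Proof. by rewrite inE => /andP[/injectiveP]. Qed.

Lemma homs_edge e f x y : f \in homs e -> eH x y -> e (f x) (f y).
Proof. by rewrite inE => /andP[_ /forallP/(_ x)/forallP/(_ y)/implyP]. Qed.

Definition few_nonneighbours e (D : nat) :=
  forall v, #|[set w | (w != v) && ~~ e v w]| <= D.

(** Having both kinds of constraint lets [card_homs_at_cons] trade a vertex required in the image
    for a sum over its possible preimages. *)
Definition homs_at e xs us ws : {set {ffun T -> U}} :=
  [set f in homs e | (map f xs == us) && all (fun w => w \in codom f) ws].

Lemma sum_preimage f u : injective f -> \sum_x (f x == u) = (u \in codom f).
Proof.
move=> finj; case: codomP => [[x ->]|Nu].
  rewrite (bigD1 x) //= eqxx big1 // => y yx.
  by rewrite (inj_eq finj) (negPf yx).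
by rewrite big1 // => x _; case: eqP => // ux; case: Nu; exists x.
Qed.

Lemma card_homs_at_cons e xs us w ws :
  #|homs_at e xs us (w :: ws)| = \sum_x #|homs_at e (x :: xs) (w :: us) ws|.
Proof.
under eq_bigr => x _ do rewrite -sum1dep_card big_mkcondr /=.
rewrite -sum1dep_card big_mkcondr exchange_big /=; apply: eq_bigr => f fh.
transitivity ((map f xs == us) && all (fun w => w \in codom f) ws *
              \sum_x (f x == w)).
  rewrite sum_preimage; last exact: homs_injective fh.
  by case: (_ == us); case: (w \in _); case: (all _ _).
rewrite big_distrr /=; apply: eq_bigr => x _; rewrite eqseq_cons.
by case: (_ == us); case: (f x == w); case: (all _ _).
Qed.

Lemma homs_at_sub e xs us : homs_at e xs us [::] \subset injections_at xs us.
Proof.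
apply/subsetP => f; rewrite !inE => /andP[/andP[-> _]].
by rewrite andbT.
Qed.

Lemma card_homs_at_le e xs us : uniq xs -> uniq us -> size xs = size us ->
  #|homs_at e xs us [::]| <= J (size us).
Proof.
move=> xs_u us_u esz; rewrite /J -(card_injections_at xs_u) //.
exact/subset_leq_card/homs_at_sub.
Qed.

Lemma homs_at_dup e xs us : uniq us -> ~~ uniq xs -> #|homs_at e xs us [::]| = 0.
Proof.
move=> us_u xsNu; apply: eq_card0 => f; rewrite inE; apply/negbTE/negP.
case/andP=> /homs_injective finj; rewrite andbT => /eqP fxs.
by rewrite -fxs map_inj_uniq // (negPf xsNu) in us_u.
Qed.

(** Union bound: an injection that is no homomorphism maps some edge of H to a non-edge. Edges
    inside [xs] never fail, and each of the at most [h ^ 2] other pairs is controlled by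
    [card_nonedge_injections]. The factor [n - h.-1] clears the denominator. *)
Lemma card_homs_at_ge e D xs us :
  symmetric e -> few_nonneighbours e D ->
  uniq xs -> uniq us -> size xs = size us ->
  (forall f a b, f \in injections_at xs us ->
     a \in xs -> b \in xs -> eH a b -> e (f a) (f b)) ->
  J (size us) * (n - h.-1) <=
  #|homs_at e xs us [::]| * (n - h.-1) + h ^ 2 * (D * J (size us)).
Proof.
move=> e_sym eD xs_u us_u esz exs.
rewrite /J -(card_injections_at xs_u) //.
pose bad (ab : T * T) :=
  [set f in injections_at xs us | eH ab.1 ab.2 && ~~ e (f ab.1) (f ab.2)].
have badP ab : #|bad ab| * (n - h.-1) <= D * #|injections_at xs us|.
  case: ab => a b; case hab: (eH a b); last first.
    rewrite (_ : bad _ = set0) ?cards0 //.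
    by apply/setP=> f; rewrite !inE /= hab !andbF.
  have Nab : a != b by apply: contraTneq hab => ->; rewrite eH_irr.
  case bxs: (b \in xs); last first.
    apply: leq_trans (card_nonedge_injections us eD Nab (negbT bxs)).
    rewrite leq_mul2r; apply/orP; right; apply/eq_leq/eq_card => f.
    by rewrite !inE /= hab.
  case axs: (a \in xs); last first.
    rewrite eq_sym in Nab.
    apply: leq_trans (card_nonedge_injections us eD Nab (negbT axs)).
    rewrite leq_mul2r; apply/orP; right; apply/eq_leq/eq_card => f.
    by rewrite !inE /= hab e_sym.
  rewrite (_ : bad _ = set0) ?cards0 //.
  apply/setP=> f; rewrite in_set0 in_set; apply/negbTE/negP.
  by move=> /andP[fI] /= /andP[_ /negP]; apply; exact: exs fI _ _ _.
have cover : injections_at xs us \subset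
    homs_at e xs us [::] :|: \bigcup_(ab : T * T) bad ab.
  apply/subsetP => f fI; rewrite in_setU; case fh: (f \in homs e).
    by move: fI; rewrite [f \in homs_at _ _ _ _]in_set fh inE => /andP[_ ->].
  apply/orP; right; apply/bigcupP.
  have finj : injectiveb f by move: fI; rewrite inE => /andP[].
  move/negbT: fh; rewrite inE finj negb_forall => /existsP[a].
  rewrite negb_forall => /existsP[b]; rewrite negb_imply => ab.
  by exists (a, b) => //; rewrite in_set fI.
have le1 : #|injections_at xs us| <=
    #|homs_at e xs us [::]| + \sum_(ab : T * T) #|bad ab|.
  apply: leq_trans (subset_leq_card cover) _.
  apply: leq_trans (leq_card_setU _ _) _; rewrite leq_add2l.
  elim/big_rec2: _ => [|ab k X _ IH]; first by rewrite cards0.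
  by apply: leq_trans (leq_card_setU _ _) _; rewrite leq_add2l.
apply: leq_trans (leq_mul le1 (leqnn _)) _.
rewrite mulnDl leq_add2l big_distrl /=.
apply: (@leq_trans (\sum_(ab : T * T) D * #|injections_at xs us|)).
  by apply: leq_sum => ab _.
by rewrite sum_nat_const card_prod -/h -mulnn.
Qed.

(** The number of ordered pairs of H that can be the preimages of two vertices of adjacency [b]: all
    pairs of distinct vertices if [b] holds, only the non-adjacent ones otherwise. *)
Definition pairs_allowed (b : bool) :=
  #|[set xy : T * T | (xy.1 != xy.2) && (eH xy.1 xy.2 ==> b)]|.

Lemma pairs_allowed_le b : pairs_allowed b <= h ^ 2.
Proof. by rewrite -mulnn -card_prod; exact: max_card. Qed.

(** Both orientations of an edge are lost between non-adjacent vertices. This gap of [2] is the main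
    term that every error estimate has to stay below. *)
Lemma pairs_allowed_gap x y : eH x y -> pairs_allowed false + 2 <= pairs_allowed true.
Proof.
move=> xy; have Nxy : x != y by apply: contraTneq xy => ->; rewrite eH_irr.
have <- : #|[set (x, y); (y, x)]| = 2.
  by rewrite cards2 xpair_eqE (negPf Nxy).
rewrite -cardsUI addnC (_ : _ :&: _ = set0) ?cards0 ?add0n; last first.
  apply/setP => -[a b]; rewrite !inE /= !xpair_eqE.
  apply/negbTE/negP => /andP[/andP[_ ab]].
  by case/orP=> /andP[/eqP ea /eqP eb]; move: ab; rewrite ea eb ?[eH y x]eH_sym xy.
apply/subset_leq_card/subsetP => -[a b]; rewrite !inE /= !xpair_eqE implybT andbT.
case/orP=> [/andP[]//|/orP[]/andP[/eqP-> /eqP->] //].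
by rewrite eq_sym.
Qed.

Lemma card_homs_through2_le e u v : symmetric e -> u != v ->
  #|homs_at e [::] [::] [:: u; v]| <= pairs_allowed (e u v) * J 2.
Proof.
move=> e_sym uv; rewrite card_homs_at_cons.
under eq_bigr => x _ do rewrite card_homs_at_cons.
rewrite pair_big /= -sum_nat_const.
rewrite (bigID (mem [set xy : T * T |
                      (xy.1 != xy.2) && (eH xy.1 xy.2 ==> e u v)])) /=.
rewrite addnC big1 ?add0n => [|[x y] /=]; last first.
  rewrite inE negb_and negbK => /orP[/eqP/= ->|].
    by rewrite homs_at_dup //= ?inE ?eqxx // eq_sym uv.
  rewrite negb_imply /= => /andP[xy Nuv]; apply: eq_card0 => f.
  rewrite !in_set; apply/negbTE/negP => /andP[fh /andP[/eqP[fy fx] _]].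
  by case/negP: Nuv; rewrite -fy -fx; apply: homs_edge xy; rewrite inE.
apply: leq_sum => -[x y]; rewrite inE /= => /andP[xy _].
by apply: card_homs_at_le => //=; rewrite inE eq_sym ?xy ?uv.
Qed.

(** By [card_homs_at_ge], each of the at most [h ^ 2] allowed pairs of preimages loses at most
    [h ^ 2 * D * J 2] divided by [n - h.-1]; the bound on [D] makes the total loss at most a tenth
    of [J 2]. *)
Lemma card_homs_through2_ge e D u v : symmetric e -> few_nonneighbours e D ->
  u != v -> 0 < n - h.-1 -> 10 * h ^ 4 * D <= n - h.-1 ->
  10 * (pairs_allowed (e u v) * J 2) <= 10 * #|homs_at e [::] [::] [:: u; v]| + J 2.
Proof.
move=> e_sym eD uv m0 hD.
set m := n - _ in m0 hD; set B := pairs_allowed _.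
set c := #|_|.
suff le1 : B * J 2 * m <= c * m + B * (h ^ 2 * (D * J 2)).
  have BH := pairs_allowed_le (e u v); rewrite -/B in BH.
  rewrite -(leq_pmul2r m0).
  have le2 : 10 * (B * (h ^ 2 * (D * J 2))) <= m * J 2.
    apply: leq_trans (leq_mul hD (leqnn _)).
    rewrite (_ : 4 = 2 + 2) // expnD.
    have := leq_mul BH (leqnn (h ^ 2 * (D * J 2))).
    move: (h ^ 2) (J 2) => h2 j2; nia.
  by move: le1 le2; set X := B * (h ^ 2 * _); nia.
rewrite /c card_homs_at_cons.
under eq_bigr => x _ do rewrite card_homs_at_cons.
rewrite pair_big /=.
pose A := [set xy : T * T | (xy.1 != xy.2) && (eH xy.1 xy.2 ==> e u v)].
apply: (@leq_trans (\sum_(xy in A)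
    (#|homs_at e [:: xy.2; xy.1] [:: v; u] [::]| * m + h ^ 2 * (D * J 2))));
  last first.
  rewrite big_split /= sum_nat_const leq_add2r -big_distrl /= leq_mul2r.
  by rewrite [X in _ <= X](bigID (mem A)) /= leq_addr orbT.
rewrite -mulnA -sum_nat_const; apply: leq_sum => -[x y].
rewrite inE /= => /andP[xy euv].
apply: (@card_homs_at_ge e D [:: y; x] [:: v; u]) => //=;
  rewrite ?inE 1?eq_sym ?xy ?uv //.
move=> f a b; rewrite !inE => /andP[_ /eqP[fy fx]].
case/orP=> /eqP->; case/orP=> /eqP->; rewrite ?eH_irr // fx fy.
  by rewrite eH_sym e_sym; move/implyP: euv.
by move/implyP: euv.
Qed.

(** For each of the [h ^ 3] triples of preimages, prescribing a third value divides the number of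
    injections by [n - 2]. *)
Lemma card_homs_through3_le e u v w : uniq [:: u; v; w] ->
  #|homs_at e [::] [::] [:: u; v; w]| * (n - 2) <= h ^ 3 * J 2.
Proof.
move=> uvw; have wvu : uniq [:: w; v; u] by rewrite -(rev_uniq [:: u; v; w]) in uvw.
have -> : h ^ 3 * J 2 = \sum_(x : T) \sum_(y : T) \sum_(z : T) J 2.
  by rewrite !sum_nat_const !expnS expn0 muln1 -!mulnA.
rewrite card_homs_at_cons big_distrl; apply: leq_sum => x _ /=.
rewrite card_homs_at_cons big_distrl; apply: leq_sum => y _ /=.
rewrite card_homs_at_cons big_distrl; apply: leq_sum => z _ /=.
have [zyx|zyx] := boolP (uniq [:: z; y; x]); last by rewrite homs_at_dup.
have [/andP[zNyx yx] /andP[wNvu vu]] := (zyx, wvu).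
rewrite /J -(@card_injections_at _ _ [:: y; x] [:: v; u]) //.
rewrite -(card_injections_at_cons zNyx wNvu vu) leq_mul2r.
by rewrite (subset_leq_card (homs_at_sub _ _ _)) orbT.
Qed.

(** Among the [J 1] injections sending [x] to [u], those sending [y] to a non-neighbour of [u] are
    no homomorphisms, and each non-neighbour accounts for [J 2] of them. *)
Lemma card_homs_through1_le e x y u : eH x y -> symmetric e ->
  #|homs_at e [::] [::] [:: u]| + #|[set w | (w != u) && ~~ e u w]| * J 2 <= h * J 1.
Proof.
move=> xy e_sym; have Nxy : y != x by apply: contraTneq xy => ->; rewrite eH_irr.
rewrite card_homs_at_cons (bigD1 x) //= addnAC.
have -> : h * J 1 = \sum_(z : T) J 1 by rewrite sum_nat_const.
rewrite [X in _ <= X](bigD1 x) //=.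
apply: leq_add; last by apply: leq_sum => z _; exact: card_homs_at_le.
rewrite /J -[X in _ <= X](@card_injections_at _ _ [:: x] [:: u]) //.
set N := [set w | _].
pose bad := [set f in injections_at [:: x] [:: u] | f y \in N].
have -> : #|N| * (n - 2) ^_ (h - 2) = #|bad|.
  rewrite -sum_nat_const -[RHS]sum1_card.
  rewrite (partition_big (fun f => f y) (mem N)) /=; last first.
    by move=> f; rewrite inE => /andP[].
  apply: eq_bigr => w; rewrite inE => /andP[wu Nuw].
  rewrite -(@card_injections_at _ _ [:: y; x] [:: w; u]) //= ?inE ?Nxy ?wu //.
  rewrite sum1dep_card; apply: eq_card => f; rewrite injections_at_cons !inE.
  by case: (f y =P w) => [->|_]; rewrite ?andbF // wu Nuw !andbT.
rewrite -cardsUI addnC (_ : _ :&: _ = set0) ?cards0 ?add0n; last first.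
  apply/setP=> f; rewrite in_set0 in_setI; apply/negbTE/negP.
  rewrite in_set [f \in bad]in_set [f y \in N]in_set.
  case/andP=> /andP[fh /andP[/eqP[fx] _]] /andP[_ /andP[_ /negP]]; apply.
  by rewrite -fx; exact: homs_edge xy.
apply/subset_leq_card/subsetP => f; rewrite in_setU.
by case/orP => [/(subsetP (homs_at_sub _ _ _))//|]; rewrite in_set => /andP[].
Qed.

End Homomorphisms.

(** * Effect of cloning vertices on the count *)

Section Cloning.

Variables (T U : finType) (eH : rel T).
Hypotheses (eH_irr : irreflexive eH) (eH_sym : symmetric eH).
Implicit Types (f : {ffun T -> U}) (e : rel U) (S : {set U}) (rho : U -> U).

Local Notation homs := (homs eH).
Local Notation homs_at e := (homs_at eH e [::] [::]).
Local Notation n := #|U|.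
Local Notation h := #|T|.
Local Notation J := (injection_count T U).

Definition pull (V W : Type) (e : rel W) (rho : V -> W) : rel V :=
  fun a b => e (rho a) (rho b).

(* [pull e (clone u v)] is [e] with [v] turned into a non-adjacent twin of [u]. *)
Definition clone (u v z : U) : U := if z == v then u else z.

Definition used f S := #|[set s in S | s \in codom f]|.

Lemma used_sum f S : used f S = \sum_(s in S) (s \in codom f).
Proof.
rewrite /used -sum1dep_card big_mkcondr.
by apply: eq_bigr => s _; case: ifP.
Qed.

Definition homs_le1 e S := [set f in homs e | used f S <= 1].
Definition homs_ge2 e S := [set f in homs e | 1 < used f S].
Definition homs_avoiding e S := [set f in homs e | used f S == 0].
Definition homs_only e S s :=
  [set f in homs e | (used f S == 1) && (s \in codom f)].

Lemma card_homs_split e S : inj_hom eH e = #|homs_le1 e S| + #|homs_ge2 e S|.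
Proof.
rewrite /inj_hom -/(homs e) -(cardsID (homs_le1 e S) (homs e)).
rewrite /homs_le1 /homs_ge2; move: (homs e) => H.
congr (_ + _); apply: eq_card => f; rewrite !inE; case: (f \in H) => //.
by rewrite andbT ltnNge.
Qed.

Lemma card_homs_le1 e S :
  #|homs_le1 e S| = #|homs_avoiding e S| + \sum_(s in S) #|homs_only e S s|.
Proof.
under eq_bigr => s _ do rewrite -sum1dep_card big_mkcondr /=.
rewrite exchange_big /= -!sum1dep_card !big_mkcondr -big_split /=.
apply: eq_bigr => f fh; have := used_sum f S.
case: (used f S) => [|[|k]] eu /=.
- by rewrite big1.
- by rewrite add0n [LHS]eu; apply: eq_bigr => s _; case: (s \in _).
- by rewrite big1.
Qed.

Lemma card_homs_avoiding_pull e S rho : (forall z, z \notin S -> rho z = z) ->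
  #|homs_avoiding (pull e rho) S| = #|homs_avoiding e S|.
Proof.
move=> rho_id; apply: eq_card => f; rewrite ![f \in _]in_set.
case u0: (used f S == 0); rewrite ?andbF // !andbT; congr (_ && _).
apply: eq_forallb => x; apply: eq_forallb => y; congr (_ ==> _).
have fS z : f z \notin S.
  apply/negP => fzS; have /eqP := cards0_eq (eqP u0).
  by move/eqP/setP/(_ (f z)); rewrite !inE fzS codom_f.
by rewrite /pull !rho_id.
Qed.

Lemma codom_tperm s t f u :
  (u \in codom (perm_comp (tperm s t) f)) = (tperm s t u \in codom f).
Proof.
apply/codomP/codomP => [[x ->]|[x eu]]; exists x.
  by rewrite ffunE tpermK.
by rewrite ffunE -eu tpermK.
Qed.

(** On a map meeting [S] in [s] alone, [rho] acts like the transposition of [s] and [rho s];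
    composing with it is the required bijection. *)
Lemma card_homs_only_pull e S rho s : (forall z, z \notin S -> rho z = z) ->
  s \in S -> rho s \in S ->
  #|homs_only (pull e rho) S s| = #|homs_only e S (rho s)|.
Proof.
move=> rho_id sS rsS; pose t := tperm s (rho s).
rewrite -(card_preimset (homs_only e S (rho s)) (@perm_comp_inj T U t)).
apply: eq_card => f.
transitivity (perm_comp t f \in homs_only e S (rho s)); last by rewrite [RHS]inE.
rewrite [LHS]in_set [RHS]in_set {2}/t codom_tperm tpermR.
have -> : used (perm_comp t f) S = used f S.
  rewrite /used -(card_preimset _ (@perm_inj _ t)); apply: eq_card => z.
  rewrite !inE codom_tperm tpermK /t; congr (_ && _).
  by case: tpermP => [->|->|]; rewrite ?sS ?rsS.
case u1: (used f S == 1); rewrite ?andbF //=.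
case sf: (s \in codom f); rewrite ?andbF // !andbT.
rewrite !in_set perm_comp_injectiveb; congr (_ && _).
have tf x : t (f x) = rho (f x).
  case fxS: (f x \in S); last first.
    rewrite rho_id ?fxS // tpermD //.
      by apply: contraFneq fxS => <-.
    by apply: contraFneq fxS => <-.
  suff -> : f x = s by rewrite tpermL.
  have /cards1P[y ey] := u1.
  have : f x \in [set y] by rewrite -ey inE fxS codom_f.
  have : s \in [set y] by rewrite -ey inE sS sf.
  by rewrite !inE => /eqP-> /eqP.
apply: eq_forallb => x; apply: eq_forallb => y; congr (_ ==> _).
by rewrite !ffunE !tf.
Qed.

(** The maps meeting [S] at most once are thus counted exactly, so in suitable combinations of
    pull-backs they cancel; only maps meeting [S] twice need estimates. *)
Lemma card_homs_le1_pull e S rho : (forall z, z \notin S -> rho z = z) ->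
  (forall z, z \in S -> rho z \in S) ->
  #|homs_le1 (pull e rho) S| =
  #|homs_avoiding e S| + \sum_(s in S) #|homs_only e S (rho s)|.
Proof.
move=> rho_id rhoS; rewrite card_homs_le1 card_homs_avoiding_pull //.
by congr (_ + _); apply: eq_bigr => s sS; rewrite card_homs_only_pull ?rhoS.
Qed.

Lemma clone_id u v z : z != v -> clone u v z = z.
Proof. by rewrite /clone => /negPf->. Qed.

Lemma cloneE u v : clone u v v = u.
Proof. by rewrite /clone eqxx. Qed.

Lemma sum_set2 (F : U -> nat) u v : u != v ->
  \sum_(s in [set u; v]) F s = F u + F v.
Proof. by move=> uv; rewrite big_setU1 ?inE //= big_set1. Qed.

Lemma sum_set3 (F : U -> nat) u v w : uniq [:: u; v; w] ->
  \sum_(s in [set u; v; w]) F s = F u + F v + F w.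
Proof.
rewrite /= !inE negb_or andbT => /andP[/andP[uv uw] vw].
by rewrite setUC big_setU1 ?inE /= ?sum_set2 1?addnC // negb_or !(eq_sym w) uw.
Qed.

Lemma card_homs_le1_clone e u v : u != v ->
  #|homs_le1 (pull e (clone u v)) [set u; v]| =
  #|homs_avoiding e [set u; v]| + 2 * #|homs_only e [set u; v] u|.
Proof.
move=> uv; rewrite card_homs_le1_pull => [|z|z]; last 2 first.
- by rewrite !inE negb_or => /andP[_ zv]; rewrite clone_id.
- by rewrite !inE /clone; case: (z == v); rewrite ?eqxx ?orbF // => ->.
by rewrite sum_set2 // cloneE clone_id // mul2n addnn.
Qed.

Lemma card_homs_ge2_pair e u v : u != v ->
  #|homs_ge2 e [set u; v]| = #|homs_at e [:: u; v]|.
Proof.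
move=> uv; apply: eq_card => f; rewrite ![f \in _]in_set used_sum sum_set2 //=.
by case: (u \in codom f); case: (v \in codom f).
Qed.

Lemma card_homs_only_pair e u v : u != v ->
  #|homs_at e [:: u]| = #|homs_only e [set u; v] u| + #|homs_at e [:: u; v]|.
Proof.
move=> uv; rewrite -!sum1dep_card !big_mkcondr -big_split /=.
apply: eq_bigr => f fh; rewrite used_sum sum_set2 //=.
by case: (u \in codom f); case: (v \in codom f).
Qed.

(** Cloning replaces the maps through [v] alone by as many as pass through [u] alone. Maps of the
    new graph through both vertices are simply discarded. *)
Lemma homs_through_clone_le e u v : u != v ->
  inj_hom eH (pull e (clone u v)) <= inj_hom eH e ->
  #|homs_at e [:: u]| <= #|homs_at e [:: v]| + #|homs_at e [:: u; v]|.
Proof.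
move=> uv; rewrite !(card_homs_split _ [set u; v]) card_homs_le1_clone //.
rewrite card_homs_le1 sum_set2 // !card_homs_ge2_pair //.
rewrite [#|homs_at e [:: u]|](card_homs_only_pair _ uv).
have := @card_homs_only_pair e v u; rewrite eq_sym setUC => /(_ uv) ->.
have -> : #|homs_at e [:: v; u]| = #|homs_at e [:: u; v]|.
  by apply: eq_card => f; rewrite !inE /= !andbT [X in _ && X]andbC.
lia.
Qed.

(** Maps meeting the pair at most once cancel. Both clonings destroy the adjacency of [u] and [v],
    so each falls short of [e] on the maps through both by at least [2 * J 2] minus the error of a
    tenth of [J 2]. *)
Lemma inj_hom_clone_pair e D u v x y :
  eH x y -> irreflexive e -> symmetric e -> few_nonneighbours e D ->
  0 < n - h.-1 -> 10 * h ^ 4 * D <= n - h.-1 -> e u v ->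
  inj_hom eH (pull e (clone u v)) + inj_hom eH (pull e (clone v u)) <=
  2 * inj_hom eH e.
Proof.
move=> xy e_irr e_sym eD m0 hD euv.
have uv : u != v by apply: contraTneq euv => ->; rewrite e_irr.
rewrite !(card_homs_split _ [set u; v]) card_homs_le1_clone //.
rewrite [X in #|homs_le1 (pull e (clone v u)) X|]setUC.
rewrite card_homs_le1_clone 1?eq_sym // [X in homs_only e X v]setUC.
rewrite [X in homs_avoiding e X]setUC.
rewrite card_homs_le1 sum_set2 // !card_homs_ge2_pair //.
have := card_homs_through2_ge eH_irr eH_sym e_sym eD uv m0 hD.
have pull_sym rho : symmetric (pull e rho) by move=> a b; rewrite /pull e_sym.
have := card_homs_through2_le eH (pull_sym (clone u v)) uv.
have := card_homs_through2_le eH (pull_sym (clone v u)) uv.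
have -> : pull e (clone u v) u v = false by rewrite /pull cloneE clone_id // e_irr.
have -> : pull e (clone v u) u v = false.
  by rewrite /pull cloneE clone_id 1?eq_sym // e_irr.
rewrite euv.
have := leq_mul (pairs_allowed_gap eH_irr eH_sym xy) (leqnn (J 2)).
rewrite mulnDl [[set v; u]]setUC; lia.
Qed.

(** A map through exactly two of the vertices lies in one of the three pair counts, a map through
    all three lies in all of them: an excess of two. *)
Lemma card_homs_ge2_triple e u v w : uniq [:: u; v; w] ->
  let c := #|homs_at e [:: u; v]| + #|homs_at e [:: u; w]| +
           #|homs_at e [:: v; w]| in
  #|homs_ge2 e [set u; v; w]| <= c <=
  #|homs_ge2 e [set u; v; w]| + 2 * #|homs_at e [:: u; v; w]|.
Proof.
move=> uvw /=; rewrite -!sum1dep_card !big_mkcondr -!big_split /=.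
rewrite big_distrr -big_split /=.
apply/andP; split; apply: leq_sum => f fh; rewrite used_sum sum_set3 //=.
  by case: (u \in codom f); case: (v \in codom f); case: (w \in codom f).
by case: (u \in codom f); case: (v \in codom f); case: (w \in codom f).
Qed.

(** The extra [#|S|.+1] covers the vertices of [S] and [rho z]; all other vertices are fixed by
    [rho]. *)
Lemma few_nonneighbours_pull e D S rho :
  few_nonneighbours e D -> (forall z, z \notin S -> rho z = z) ->
  few_nonneighbours (pull e rho) (D + #|S|.+1).
Proof.
move=> eD rho_id z.
apply: (@leq_trans #|[set w | (w != rho z) && ~~ e (rho z) w] :|: (rho z |: S)|).
  apply/subset_leq_card/subsetP => w; rewrite !inE /pull => /andP[_].
  case wS: (w \in S); rewrite ?orbT // (rho_id w) ?wS // => ->.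
  by case: (w == _).
apply: leq_trans (leq_card_setU _ _) _; apply: leq_add => //.
by apply: leq_trans (leq_card_setU _ _) _; rewrite cards1.
Qed.

(* Comparing [e] with the three graphs in which [v] is turned into a clone of
   [u], [v] into a clone of [w], and both [u], [w] into clones of [v]: maps that
   meet the triple at most once cancel out, and the three modified graphs have
   in total one edge more inside the triple than three copies of [e]. *)
Lemma nonadjacency_trans e D u v w x y :
  eH x y -> irreflexive e -> symmetric e -> few_nonneighbours e D ->
  (forall rho, inj_hom eH (pull e rho) <= inj_hom eH e) ->
  h <= n -> 10 * h ^ 4 * (D + 4) <= n - h.-1 -> 6 * h ^ 3 <= n - 2 ->
  ~~ e u v -> ~~ e v w -> ~~ e u w.
Proof.
move=> xy e_irr e_sym eD emax hn hD hn3 Nuv Nvw; apply/negP => euw.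
have h0 : 0 < h by rewrite (cardD1 x).
have n0 : 0 < n - h.-1 by rewrite subn_gt0 prednK.
have uw : u != w by apply: contraTneq euw => ->; rewrite e_irr.
have uv : u != v by apply: contraTneq euw => ->.
have vw : v != w by apply: contraTneq euw => <-.
have uvw : uniq [:: u; v; w] by rewrite /= !inE negb_or uv uw vw.
pose S := [set u; v; w].
have cS : #|S| = 3.
  by rewrite /S -sum1_card sum_set3.
pose ra := clone u v; pose rb := clone w v.
pose rc := fun z => if z \in S then v else z.
have J2 : 0 < J 2 by rewrite ffact_gt0 leq_sub2r.
have c3 rho : 6 * #|homs_at (pull e rho) [:: u; v; w]| <= J 2.
  have := card_homs_through3_le eH (pull e rho) uvw.
  move: (homs_at _ _) => X.
  have n2 : 0 < h ^ 3 by rewrite expn_gt0 h0.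
  by move: (h ^ 3) (n - 2) hn3 n2; clear => h3 n2; nia.
have ra_id z : z \notin S -> ra z = z.
  by rewrite !inE !negb_or => /andP[/andP[_ zv] _]; rewrite /ra clone_id.
have rb_id z : z \notin S -> rb z = z.
  by rewrite !inE !negb_or => /andP[/andP[_ zv] _]; rewrite /rb clone_id.
have rc_id z : z \notin S -> rc z = z by rewrite /rc => /negPf->.
have raS z : z \in S -> ra z \in S.
  by rewrite /ra /clone; case: eqP => // _ _; rewrite !inE eqxx.
have rbS z : z \in S -> rb z \in S.
  by rewrite /rb /clone; case: eqP => // _ _; rewrite !inE eqxx !orbT.
have rcS z : z \in S -> rc z \in S.
  by rewrite /rc => ->; rewrite !inE eqxx orbT.
have [uS vS wS] : [/\ u \in S, v \in S & w \in S] by rewrite !inE !eqxx !orbT.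
have rau : ra u = u by rewrite /ra clone_id.
have rav : ra v = u by rewrite /ra cloneE.
have raw : ra w = w by rewrite /ra clone_id // eq_sym.
have rbu : rb u = u by rewrite /rb clone_id.
have rbv : rb v = w by rewrite /rb cloneE.
have rbw : rb w = w by rewrite /rb clone_id // eq_sym.
have rcu : rc u = v by rewrite /rc uS.
have rcv : rc v = v by rewrite /rc vS.
have rcw : rc w = v by rewrite /rc wS.
have pull_sym rho : symmetric (pull e rho) by move=> a b; rewrite /pull e_sym.
have pullD rho : (forall z, z \notin S -> rho z = z) ->
    few_nonneighbours (pull e rho) (D + 4).
  by move=> rho_id; rewrite -cS; exact: few_nonneighbours_pull.
have [/andP[_ ga] /andP[_ gb]] :=
  (card_homs_ge2_triple (pull e ra) uvw, card_homs_ge2_triple (pull e rb) uvw).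
have [/andP[_ gc] /andP[ge _]] :=
  (card_homs_ge2_triple (pull e rc) uvw, card_homs_ge2_triple e uvw).
have ge2 rho (rho_id : forall z, z \notin S -> rho z = z) p q (pq : p != q) :=
  card_homs_through2_ge eH_irr eH_sym (pull_sym rho) (pullD rho rho_id) pq n0 hD.
have := ge2 _ ra_id _ _ uv; have := ge2 _ ra_id _ _ uw; have := ge2 _ ra_id _ _ vw.
have := ge2 _ rb_id _ _ uv; have := ge2 _ rb_id _ _ uw; have := ge2 _ rb_id _ _ vw.
have := ge2 _ rc_id _ _ uv; have := ge2 _ rc_id _ _ uw; have := ge2 _ rc_id _ _ vw.
have := card_homs_through2_le eH e_sym uv.
have := card_homs_through2_le eH e_sym uw.
have := card_homs_through2_le eH e_sym vw.
have -> : pull e ra u v = false by rewrite /pull rau rav.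
have -> : pull e ra u w by rewrite /pull rau raw.
have -> : pull e ra v w by rewrite /pull rav raw.
have -> : pull e rb u v by rewrite /pull rbu rbv.
have -> : pull e rb u w by rewrite /pull rbu rbw.
have -> : pull e rb v w = false by rewrite /pull rbv rbw.
have -> : pull e rc u v = false by rewrite /pull rcu rcv.
have -> : pull e rc u w = false by rewrite /pull rcu rcw.
have -> : pull e rc v w = false by rewrite /pull rcv rcw.
rewrite (negPf Nuv) (negPf Nvw) euw.
have := c3 ra; have := c3 rb; have := c3 rc.
have := leq_mul (pairs_allowed_gap eH_irr eH_sym xy) (leqnn (J 2)).
rewrite mulnDl; have := emax rc; have := emax rb; have := emax ra.
rewrite !(card_homs_split _ S) [#|homs_le1 e S|]card_homs_le1.
rewrite (card_homs_le1_pull e ra_id) // (card_homs_le1_pull e rb_id) //.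
rewrite (card_homs_le1_pull e rc_id) // !sum_set3 //.
rewrite rau rav raw rbu rbv rbw rcu rcv rcw.
(* The gain is at least [2 * J 2]. Against it stand nine pair errors of [J 2] over 10 and three
   triple corrections of at most twice [J 2] over 6, in total 1.9 times [J 2]. *)
move: J2 ga gb gc ge; rewrite -/S; clear.
move: (J 2) (pairs_allowed _ false * _) (pairs_allowed _ true * _) => j a b.
by repeat match goal with |- context [#|?X|] => move: #|X| => ? end; lia.
Qed.

End Cloning.

(** * Graphs whose count no pull-back increases *)

Section PullbackMaximal.

Variables (T U : finType) (eH : rel T).
Hypotheses (eH_irr : irreflexive eH) (eH_sym : symmetric eH).
Implicit Type e : rel U.

Local Notation n := #|U|.
Local Notation h := #|T|.
Local Notation J := (injection_count T U).

Lemma sum_homs_through1 e :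
  \sum_u #|homs_at eH e [::] [::] [:: u]| = h * inj_hom eH e.
Proof.
under eq_bigr => u _ do rewrite card_homs_at_cons.
rewrite exchange_big /= -sum_nat_const; apply: eq_bigr => x _.
rewrite /inj_hom -/(homs eH e) -sum1_card.
rewrite (partition_big (fun f : {ffun T -> U} => f x) predT) //=.
apply: eq_bigr => u _; rewrite sum1dep_card; apply: eq_card => f.
by rewrite [LHS]in_set [RHS]in_set /= eqseq_cons eqxx !andbT.
Qed.

(** The count of [e] is at least that of [e0], which is close to the number [J 0] of all injections.
    Since no cloning helps, the counts through single vertices are nearly equal, so each is close to
    [h * J 1], and [card_homs_through1_le] leaves room for few non-neighbours. *)
Lemma few_nonneighbours_of_maximal e e0 D0 x y :
  eH x y -> irreflexive e -> symmetric e ->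
  (forall rho : U -> U, inj_hom eH (pull e rho) <= inj_hom eH e) ->
  symmetric e0 -> few_nonneighbours e0 D0 -> inj_hom eH e0 <= inj_hom eH e ->
  h <= n -> n.-1 <= 2 * (n - h.-1) ->
  few_nonneighbours e (2 * h ^ 3 * D0 + h ^ 2).
Proof.
move=> xy e_irr e_sym emax e0_sym e0D e0e hn hm v.
have Nxy : x != y by apply: contraTneq xy => ->; rewrite eH_irr.
have h2 : 1 < h by apply/card_gt1P; exists x, y.
set d := #|_|; set m := n - _ in hm.
have m0 : 0 < m by rewrite /m; lia.
have J2 : 0 < J 2 by rewrite ffact_gt0; lia.
have J10 : J 0 = n * J 1.
  by rewrite /injection_count !subn0 -{1}(prednK (ltnW h2)) ffactnS !subn1.
have J21 : J 1 = n.-1 * J 2.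
  rewrite /injection_count !subn1 -{1}(prednK (_ : 0 < h.-1)) ?ffactnS; last lia.
  by congr (_ * _ ^_ _); lia.
pose c u := #|homs_at eH e [::] [::] [:: u]|.
have cuv u : c u <= c v + h ^ 2 * J 2.
  have [->|uv] := eqVneq u v; first exact: leq_addr.
  apply: leq_trans (homs_through_clone_le uv (emax _)) _; rewrite leq_add2l.
  apply: leq_trans (card_homs_through2_le _ e_sym uv) _.
  by rewrite leq_mul2r pairs_allowed_le orbT.
have sum_c : h * inj_hom eH e <= n * (c v + h ^ 2 * J 2).
  rewrite -sum_homs_through1 -sum_nat_const.
  by apply: leq_sum => u _; exact: cuv.
have cv : c v + d * J 2 <= h * J 1 by exact: card_homs_through1_le xy e_sym.
have e0_ge : J 0 * m <= inj_hom eH e0 * m + h ^ 2 * (D0 * J 0).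
  have := @card_homs_at_ge T U eH eH_irr e0 D0 [::] [::] e0_sym e0D.
  rewrite (_ : #|homs_at _ _ _ _ _| = inj_hom eH e0) => [|]; last first.
    by apply: eq_card => f; rewrite [LHS]in_set /= andbT.
  by apply.
(* The bound [n.-1 <= 2 * m] produces the factor 2 in the conclusion. *)
suff le_d : m * d <= h ^ 3 * D0 * n.-1 + m * h ^ 2.
  rewrite -(leq_pmul2l m0); apply: leq_trans le_d _.
  have := leq_mul (leqnn (h ^ 3 * D0)) hm; lia.
have n0 : 0 < n by lia.
rewrite -(leq_pmul2r J2) -(leq_pmul2l n0).
set F := inj_hom eH e in e0e sum_c.
have le1 : h * F + n * (d * J 2) <= h * J 0 + n * (h ^ 2 * J 2).
  by move: (leq_mul (leqnn n) cv) sum_c; rewrite J10; lia.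
have le2 : J 0 * m <= F * m + h ^ 2 * (D0 * J 0).
  by apply: leq_trans e0_ge _; rewrite leq_add2r leq_mul2r e0e orbT.
have le3 : n * (d * J 2) * m <= h * (h ^ 2 * (D0 * J 0)) + n * (h ^ 2 * J 2) * m.
  have := leq_mul le1 (leqnn m); have := leq_mul (leqnn h) le2.
  rewrite !mulnDl !mulnDr; lia.
move: le3; rewrite J10 J21 expnS; lia.
Qed.

Lemma eq_inj_hom e e' : e =2 e' -> inj_hom eH e = inj_hom eH e'.
Proof.
move=> ee; apply: eq_card => f; rewrite !inE; congr (_ && _).
by apply: eq_forallb => x; apply: eq_forallb => y; rewrite ee.
Qed.

Lemma inj_hom_pull_perm e (p : {perm U}) : inj_hom eH (pull e p) = inj_hom eH e.
Proof.
rewrite /inj_hom -!/(homs eH _) -[RHS](card_preimset _ (@perm_comp_inj T U p)).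
apply: eq_card => f; rewrite !inE perm_comp_injectiveb; congr (_ && _).
by apply: eq_forallb => x; apply: eq_forallb => y; rewrite !ffunE.
Qed.

(** As [e] has no loops, [rho] is injective on a clique of the pull-back and maps it to a clique of
    the same size. *)
Lemma Kfree_pull e (rho : U -> U) k :
  irreflexive e -> Kfree e k -> Kfree (pull e rho) k.
Proof.
move=> e_irr eK [S [cS clS]]; apply: eK.
have rinj : {in S &, injective rho}.
  move=> a b aS bS; apply: contra_eq => ab.
  by apply: contraTneq (clS a b aS bS ab) => eab; rewrite /pull eab e_irr.
exists (rho @: S); split; first by rewrite card_in_imset.
move=> _ _ /imsetP[a aS ->] /imsetP[b bS ->] ab.
by apply: clS => //; apply: contraNneq ab => ->.
Qed.

End PullbackMaximal.

(** * Complete multipartite graphs given by colourings *)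

Section Colourings.

Variables n r : nat.
Implicit Types (k : 'I_n -> 'I_r) (x : 'I_n) (c : 'I_r).

(** As a pull-back, it turns under a further pull-back along [rho] into the multipartite graph of
    [k] composed with [rho]. Colour classes may be empty. *)
Definition multipartite k : rel 'I_n := pull (fun c d => c != d) k.

Definition class_size k c := #|[set z | k z == c]|.

Definition recolour k x c : 'I_n -> 'I_r := fun z => if z == x then c else k z.

Definition balanced k := forall c d, class_size k c <= (class_size k d).+1.

Lemma class_size_sum k c : class_size k c = \sum_z (k z == c).
Proof.
rewrite /class_size -sum1dep_card big_mkcond.
by apply: eq_bigr => z _; case: eqP.
Qed.

Lemma sum_class_size k : \sum_c class_size k c = n.
Proof.
under eq_bigr => c _ do rewrite class_size_sum.
rewrite exchange_big /= -[RHS]card_ord -sum1_card; apply: eq_bigr => z _.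
rewrite (bigD1 (k z)) //= eqxx big1 // => c ck.
by rewrite eq_sym (negPf ck).
Qed.

Lemma class_size_recolour k x d c :
  class_size (recolour k x d) c + (k x == c) = class_size k c + (d == c).
Proof.
rewrite !class_size_sum !(bigD1 x (P := predT)) //= {1}/recolour eqxx.
rewrite (eq_bigr (fun z => (k z == c : nat))) => [|z zx]; last first.
  by rewrite /recolour (negPf zx).
lia.
Qed.

(** This is the tie-breaker: among colourings with the same count, one with the least sum of squares
    cannot be improved by such a move. *)
Lemma sum_sqr_recolour k x d :
  (class_size k d).+1 < class_size k (k x) ->
  \sum_c class_size (recolour k x d) c ^ 2 < \sum_c class_size k c ^ 2.
Proof.
move=> lt_d; have id' : d != k x by apply: contraTneq lt_d => ->; lia.
rewrite !(bigD1 (k x) (P := predT)) //= !(bigD1 d (P := fun c => c != k x)) //=.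
have -> : \sum_(c | (c != k x) && (c != d)) class_size (recolour k x d) c ^ 2 =
          \sum_(c | (c != k x) && (c != d)) class_size k c ^ 2.
  apply: eq_bigr => c /andP[ck cd]; congr (_ ^ _).
  have := class_size_recolour k x d c.
  by rewrite !(eq_sym _ c) (negPf ck) (negPf cd) !addn0.
have sizek : (class_size (recolour k x d) (k x)).+1 = class_size k (k x).
  by have := class_size_recolour k x d (k x); rewrite eqxx (negPf id') addn0 addn1.
have sized : class_size (recolour k x d) d = (class_size k d).+1.
  by have := class_size_recolour k x d d; rewrite eqxx eq_sym (negPf id') addn0 addn1.
move: lt_d; rewrite sized -sizek -!mulnn ltnS.
move: (class_size _ (k x)) (class_size k d) (\sum_(c | _) _) => X b s; nia.
Qed.

Lemma multipartite_irr k : irreflexive (multipartite k).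
Proof. by move=> a; rewrite /multipartite /pull eqxx. Qed.

Lemma multipartite_sym k : symmetric (multipartite k).
Proof. by move=> a b; rewrite /multipartite /pull eq_sym. Qed.

Lemma card_nonneighbours_multipartite k v :
  #|[set w | (w != v) && ~~ multipartite k v w]|.+1 = class_size k (k v).
Proof.
rewrite /class_size [RHS](cardsD1 v) inE eqxx add1n; congr _.+1.
by apply: eq_card => w; rewrite !inE /multipartite /pull negbK eq_sym [k v == _]eq_sym.
Qed.

Variables (T : finType) (eH : rel T).

(** Up to renaming colours by [p], the two colourings list the same multiset of colours, so a vertex
    permutation [q] carries one to the other. *)
Lemma inj_hom_multipartite_perm k k' (p : {perm 'I_r}) :
  (forall c, class_size k c = class_size k' (p c)) ->
  inj_hom eH (multipartite k) = inj_hom eH (multipartite k').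
Proof.
move=> ksize.
have /tuple_permP[q eq_q] :
    perm_eq [seq p (k i) | i <- enum 'I_n] [tuple k' i | i < n].
  apply/allP => c _ /=.
  rewrite [X in X == _]count_map [X in _ == X]count_map.
  have countE (a : pred 'I_n) : count a (enum 'I_n) = #|[set z | a z]|.
    by rewrite cardsE cardE -size_filter enumT.
  rewrite !countE; apply/eqP; have := ksize (p^-1 c)%g; rewrite permKV.
  move=> kE; rewrite -[RHS]/(class_size k' c) -kE; apply: eq_card => z.
  by rewrite !inE /= -(inj_eq (@perm_inj _ p) (k z)) permKV.
have kq z : k' (q z) = p (k z).
  have /(congr1 (fun s => nth (p (k z)) s z)) := eq_q.
  rewrite (nth_map z) ?size_enum_ord // nth_ord_enum.
  by rewrite -tnth_nth !tnth_mktuple => ->.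
rewrite -(inj_hom_pull_perm _ (multipartite k') q); apply: eq_inj_hom => a b.
by rewrite /multipartite /pull !kq (inj_eq perm_inj).
Qed.

Hypotheses (eH_irr : irreflexive eH) (eH_sym : symmetric eH).

(* Moving [x] and another vertex of its class one after the other gives three
   colourings whose counts are concave; iterate until the two class sizes are
   exchanged. *)
Lemma inj_hom_recolour_ge (D : nat) a b k x d : eH a b ->
  0 < n - #|T|.-1 -> 10 * #|T| ^ 4 * D <= n - #|T|.-1 ->
  (forall c, class_size k c <= D) -> class_size k d < class_size k (k x) ->
  inj_hom eH (multipartite k) <= inj_hom eH (multipartite (recolour k x d)).
Proof.
move=> ab m0 hD; move sE: (class_size k (k x) - class_size k d) => s.
elim/ltn_ind: s k x sE => s IH k x sE kD lt_d.
set i := k x in sE lt_d.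
have id' : i != d by apply: contraTneq lt_d => ->; rewrite ltnn.
set k1 := recolour k x d.
have size1 c := class_size_recolour k x d c; rewrite -/i -/k1 in size1.
have size1i : (class_size k1 i).+1 = class_size k i.
  by have := size1 i; rewrite eqxx eq_sym (negPf id') addn1 addn0.
have size1d : class_size k1 d = (class_size k d).+1.
  by have := size1 d; rewrite eqxx (negPf id') addn1 addn0.
have size1c c : c != i -> c != d -> class_size k1 c = class_size k c.
  move=> ci cd; have := size1 c.
  by rewrite !(eq_sym _ c) (negPf ci) (negPf cd) !addn0.
have swap k' : class_size k' i = class_size k d ->
    class_size k' d = class_size k i ->
    (forall c, c != i -> c != d -> class_size k' c = class_size k c) ->
    inj_hom eH (multipartite k) = inj_hom eH (multipartite k').
  move=> k'i k'd k'c; apply: (@inj_hom_multipartite_perm _ _ (tperm i d)) => c.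
  by case: tpermP => [->|->|/eqP ci /eqP cd] //; rewrite k'c.
(* At difference 1 the move already exchanges the two class sizes. *)
have [s1|s2] : s = 1 \/ 1 < s by lia.
  by rewrite (swap k1) //; lia.
have [x' kx' x'x] : exists2 x', k x' = i & x' != x.
  have /card_gt1P[y [z [yi zi yz]]] : 1 < class_size k i by lia.
  rewrite !inE in yi zi; have [yx|yx] := eqVneq y x.
    by exists z; [exact/eqP | rewrite eq_sym -yx].
  by exists y => //; apply/eqP.
have k1x : k1 x = d by rewrite /k1 /recolour eqxx.
have k1x' : k1 x' = i by rewrite /k1 /recolour (negPf x'x).
pose k2 := recolour k1 x' d.
have size2 c := class_size_recolour k1 x' d c; rewrite -/k2 k1x' in size2.
have k1D c : class_size k1 c <= D.
  have [->|ci] := eqVneq c i; first by have := kD i; lia.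
  have [->|cd] := eqVneq c d; first by have := kD i; lia.
  by rewrite size1c.
(* In [k1], [x'] has colour [i] and [x] has colour [d]: making [x] a clone of [x'] restores [k],
   making [x'] a clone of [x] gives [k2]. *)
have concave : inj_hom eH (multipartite k) + inj_hom eH (multipartite k2) <=
    2 * inj_hom eH (multipartite k1).
  have few1 : few_nonneighbours (multipartite k1) D.
    move=> v; apply: leq_trans (k1D (k1 v)).
    by rewrite -card_nonneighbours_multipartite.
  have adj1 : multipartite k1 x' x by rewrite /multipartite /pull k1x k1x'.
  have := @inj_hom_clone_pair T _ eH eH_irr eH_sym _ D x' x a b ab
    (multipartite_irr k1) (multipartite_sym k1) few1.
  rewrite card_ord => /(_ m0 hD adj1); congr (_ + _ <= _).
    apply: eq_inj_hom => y z; rewrite /multipartite /pull.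
    have kE w : k1 (clone x' x w) = k w.
      rewrite /clone; case: eqP => [->|/eqP/negPf wx] //.
      by rewrite /k1 /recolour wx.
    by rewrite !kE.
  apply: eq_inj_hom => y z; rewrite /multipartite /pull.
  have kE w : k1 (clone x x' w) = k2 w.
    by rewrite /clone /k2 /recolour; case: eqP.
  by rewrite !kE.
have [s2'|s3] : s = 2 \/ 2 < s by lia.
  suff kk2 : inj_hom eH (multipartite k) = inj_hom eH (multipartite k2) by lia.
  apply: swap => [||c ci cd].
  - by have := size2 i; rewrite eqxx eq_sym (negPf id'); lia.
  - by have := size2 d; rewrite eqxx (negPf id'); lia.
  rewrite -size1c //; have := size2 c.
  by rewrite !(eq_sym _ c) (negPf ci) (negPf cd) !addn0.
(* The move from [k1] to [k2] starts at difference [s - 2]; if it does not lower the count,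
   concavity shows that the move from [k] to [k1] does not either. *)
suff : inj_hom eH (multipartite k1) <= inj_hom eH (multipartite k2) by lia.
apply: (IH (s - 2)) => //; rewrite ?k1x'; lia.
Qed.

(** A class below [n %/ r] would keep all classes at most [n %/ r], and one above [(n %/ r).+1]
    would push all to at least [(n %/ r).+1]; neither is compatible with the total [n]. *)
Lemma balanced_class_size k c : balanced k -> n %/ r <= class_size k c <= (n %/ r).+1.
Proof.
move=> kb; have r0 : 0 < r by case: (c) => m; lia.
have sumk := sum_class_size k.
have sum_const q : \sum_(d < r) q = r * q by rewrite sum_nat_const card_ord.
apply/andP; split; rewrite leqNgt; apply/negP => lt_c.
  suff : n < n %/ r * r by rewrite ltnNge leq_divM.
  rewrite -{1}sumk mulnC -sum_const (bigD1 c) //= [X in _ < X](bigD1 c) //=.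
  rewrite -addSn; apply: leq_add => //; apply: leq_sum => d _.
  exact: leq_trans (kb d c) lt_c.
have := ltn_ceil n r0; rewrite ltnNge => /negP; apply.
rewrite -{2}sumk mulnC -sum_const; apply: leq_sum => d _.
by have := leq_trans lt_c (kb c d).
Qed.

(** The total [n] forces exactly [n %% r] classes to be the larger ones, so all balanced colourings
    share one multiset of class sizes. *)
Lemma count_balanced_class_size k q : 0 < r -> balanced k ->
  count_mem q [seq class_size k c | c <- enum 'I_r] =
  if q == n %/ r then r - n %% r else if q == (n %/ r).+1 then n %% r else 0.
Proof.
move=> r0 kb; rewrite count_map.
have countE (a : pred 'I_r) : count a (enum 'I_r) = \sum_c a c.
  rewrite -sum1_count big_enum_cond /= big_mkcond.
  by apply: eq_bigr => c _; case: (a c).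
have kE c : class_size k c = n %/ r + (class_size k c == (n %/ r).+1).
  by have := balanced_class_size c kb; case: eqP; lia.
have big_count : \sum_c (class_size k c == (n %/ r).+1) = n %% r.
  have := sum_class_size k; rewrite {1}(divn_eq n r).
  rewrite (eq_bigr _ (fun c _ => kE c)) big_split /= sum_nat_const card_ord; lia.
have small_count : \sum_c (class_size k c == n %/ r) = r - n %% r.
  suff : \sum_c (class_size k c == n %/ r) + n %% r = r by lia.
  rewrite -big_count -big_split -[RHS](card_ord r) -sum1_card /=.
  by apply: eq_bigr => c _; have := kE c; do 2!case: eqP; lia.
rewrite countE; case: eqP => [->|q0] //; case: eqP => [->|q1] //.
by rewrite big1 // => c _ /=; have := kE c; case: eqP => //; case: eqP => /=; lia.
Qed.

Lemma inj_hom_balanced k k' : 0 < r -> balanced k -> balanced k' ->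
  inj_hom eH (multipartite k) = inj_hom eH (multipartite k').
Proof.
move=> r0 kb kb'.
have /tuple_permP[p eq_p] :
    perm_eq [seq class_size k c | c <- enum 'I_r] [tuple class_size k' c | c < r].
  by apply/allP => q _; rewrite /= !count_balanced_class_size.
apply: (@inj_hom_multipartite_perm _ _ p) => c.
have /(congr1 (fun s => nth 0 s c)) := eq_p.
rewrite (nth_map c) ?size_enum_ord // nth_ord_enum.
by rewrite -tnth_nth !tnth_mktuple.
Qed.

End Colourings.

(** * The Turan graph and recognition of multipartite graphs *)

Section Turan.

Variables n r : nat.
Hypothesis r_gt0 : 0 < r.

Definition turan_colour (i : 'I_n) : 'I_r := Ordinal (ltn_pmod i r_gt0).

Lemma class_size_turan c : class_size turan_colour c = (n + (r.-1 - c)) %/ r.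
Proof.
have ltc := ltn_ord c.
transitivity (\sum_(i < n) (i %% r == c)); first exact: class_size_sum.
elim: n => [|m IHm]; first by rewrite big_ord0 divn_small //; lia.
(* The quotient grows by one exactly when [r] divides the new numerator, that is when [m %% r]
   equals [c]. *)
rewrite big_ord_recr /= IHm addSn divnS // addnC; congr (_ + _).
have -> : (m + (r.-1 - c)).+1 = (m + r) - c by lia.
by rewrite -eqn_mod_dvd ?modnDr ?(modn_small ltc) //; lia.
Qed.

Lemma balanced_turan : balanced turan_colour.
Proof.
move=> c d; rewrite !class_size_turan.
have <- : (r + (n + (r.-1 - d))) %/ r = ((n + (r.-1 - d)) %/ r).+1.
  by rewrite divnDl ?dvdnn // divnn r_gt0.
apply: leq_div2r; lia.
Qed.

Lemma inj_hom_turan (T : finType) (eH : rel T) :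
  inj_hom eH (turan_rel n r) = inj_hom eH (multipartite turan_colour).
Proof. by apply: eq_inj_hom. Qed.

(* A complement graph that is an equivalence relation has at most [r] classes,
   since a transversal of the classes is a clique. *)
Lemma multipartite_of_nonadjacency_trans (e : rel 'I_n) :
  simple_graph e -> Kfree e r.+1 ->
  (forall u v w, ~~ e u v -> ~~ e v w -> ~~ e u w) ->
  exists k : 'I_n -> 'I_r, e =2 multipartite k.
Proof.
case=> e_irr e_sym eK etrans.
(* The vertex returned by [pick] depends only on the predicate, hence only on the class of [a]; the
   default is never reached, since [a] is not adjacent to itself. *)
pose rep a := odflt a [pick b | ~~ e a b].
have repP a : ~~ e a (rep a).
  by rewrite /rep; case: pickP => //= _; rewrite e_irr.
have rep_eq a b : (rep a == rep b) = ~~ e a b.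
  apply/eqP/idP => [eab|Nab].
    by apply: etrans (repP a) _; rewrite eab e_sym.
  rewrite /rep (@eq_pick _ _ (fun c => ~~ e b c)); last first.
    move=> c; apply/idP/idP => [ac|bc]; last exact: etrans bc.
    by apply: etrans ac; rewrite e_sym.
  by case: pickP => //= /(_ b); rewrite e_irr.
pose P := rep @: [set: 'I_n].
have clP : {in P &, forall a b, a != b -> e a b}.
  move=> _ _ /imsetP[a _ ->] /imsetP[b _ ->]; apply: contraR => Nab.
  have Nba : ~~ e (rep b) b by rewrite e_sym.
  by rewrite rep_eq; exact: etrans (repP a) (etrans _ _ _ Nab Nba).
have cP : #|P| <= r.
  rewrite leqNgt; apply/negP => ltP; apply: eK.
  have /card_geqP[s [s_uniq s_size sP]] := ltP.
  exists [set z in s]; split; first by rewrite cardsE (card_uniqP s_uniq).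
  by move=> a b; rewrite !inE => /sP aP /sP bP; exact: clP.
have idx a : index (rep a) (enum P) < r.
  apply: leq_trans cP; rewrite cardE index_mem mem_enum.
  by apply: imset_f; rewrite inE.
exists (fun a => Ordinal (idx a)) => a b.
rewrite /multipartite /pull -val_eqE /=.
have memP c : rep c \in enum P by rewrite mem_enum imset_f ?inE.
have -> : (index (rep a) (enum P) == index (rep b) (enum P)) = (rep a == rep b).
  apply/eqP/eqP => [ab|->] //.
  by rewrite -(nth_index a (memP a)) ab nth_index.
by rewrite rep_eq negbK.
Qed.

End Turan.

(** * Degenerate cases and the extremal argument *)

Lemma inj_hom_edgeless (T U : finType) (eH : rel T) (e e' : rel U) :
  (forall x y, ~~ eH x y) -> inj_hom eH e = inj_hom eH e'.
Proof.
move=> eH0; apply: eq_card => f; rewrite !inE; congr (_ && _).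
by apply: eq_forallb => x; apply: eq_forallb => y; rewrite (negPf (eH0 x y)).
Qed.

(** Residues modulo [r] are then distinct, so the Turan graph is complete and every injection
    counts. *)
Lemma inj_hom_le_turan_small (T : finType) (eH : rel T) (r n : nat) (e : rel 'I_n) :
  irreflexive eH -> n <= r -> inj_hom eH e <= inj_hom eH (turan_rel n r).
Proof.
move=> eH_irr nr; apply/subset_leq_card/subsetP => f; rewrite !inE.
case/andP=> finj _; rewrite finj; apply/forallP => x; apply/forallP => y.
apply/implyP => xy; rewrite /turan_rel !modn_small ?(leq_trans (ltn_ord _)) //.
rewrite val_eqE (inj_eq (injectiveP _ finj)).
by apply: contraTneq xy => ->; rewrite eH_irr.
Qed.

Theorem theorem1p3 (T : finType) (eH : rel T) (r n : nat) (eG : rel 'I_n) :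
  simple_graph eH -> simple_graph eG ->
  300 * #|T| ^ 9 <= r -> 0 < n ->
  Kfree eG r.+1 ->
  inj_hom eH eG <= inj_hom eH (turan_rel n r).
Proof.
move=> [eH_irr eH_sym] [eG_irr eG_sym] hr n0 eGK.
have [nr|rn] := leqP n r; first exact: inj_hom_le_turan_small.
have [/existsP[a /existsP[b ab]]|noedge] :=
  boolP [exists x, exists y, eH x y]; last first.
  rewrite (inj_hom_edgeless eG (turan_rel n r)) // => x y.
  by apply: contra noedge => xy; apply/existsP; exists x; apply/existsP; exists y.
have h0 : 0 < #|T| by rewrite (cardD1 a).
have r0 : 0 < r by apply: leq_trans hr; rewrite muln_gt0 expn_gt0 h0.
rewrite leqNgt; apply/negP => lt_turan.
(* The bound of [few_nonneighbours_of_maximal] for the Turan graph as [e0], whose vertices have at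
   most [n %/ r] non-neighbours. *)
pose D := 2 * #|T| ^ 3 * (n %/ r) + #|T| ^ 2.
have hX i : i <= 9 -> #|T| ^ i <= #|T| ^ 9 by move=> i9; exact: leq_pexp2l.
have h1 := hX 1 isT; rewrite expn1 in h1.
have [h3 h4] := (hX 3 isT, hX 4 isT); have [h6 h7] := (hX 6 isT, hX 7 isT).
have hn : #|T| <= #|'I_n| by rewrite card_ord; lia.
have hm : #|'I_n|.-1 <= 2 * (#|'I_n| - #|T|.-1) by rewrite card_ord; lia.
have hn3 : 6 * #|T| ^ 3 <= #|'I_n| - 2.
  by rewrite card_ord; have := expn_gt0 #|T| 9; rewrite h0; lia.
(* Here the size of [r] is decisive: the leading term is [20 * #|T| ^ 7 * (n %/ r)], and [n %/ r] is
   at most [n] over [300 * #|T| ^ 9]; the other terms are small since [n] exceeds [r]. *)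
have hD : 10 * #|T| ^ 4 * (D + 4) <= #|'I_n| - #|T|.-1.
  have qn : 300 * #|T| ^ 9 * (n %/ r) <= n.
    by apply: leq_trans (leq_divM n r); rewrite mulnC leq_mul2l hr orbT.
  have h7q : #|T| ^ 7 * (n %/ r) <= #|T| ^ 9 * (n %/ r).
    by rewrite leq_mul2r h7 orbT.
  have -> : 10 * #|T| ^ 4 * (D + 4) =
      20 * (#|T| ^ 7 * (n %/ r)) + 10 * #|T| ^ 6 + 40 * #|T| ^ 4.
    by rewrite /D (expnD _ 3 4) (expnD _ 2 4); lia.
  rewrite card_ord; lia.
have few_turan : few_nonneighbours (multipartite (@turan_colour n r r0)) (n %/ r).
  move=> v; rewrite -ltnS card_nonneighbours_multipartite.
  by have /andP[] := balanced_class_size (turan_colour r0 v) (@balanced_turan n r r0).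
have few_max (e : rel 'I_n) : irreflexive e -> symmetric e ->
    (forall rho : 'I_n -> 'I_n, inj_hom eH (pull e rho) <= inj_hom eH e) ->
    inj_hom eH (turan_rel n r) <= inj_hom eH e -> few_nonneighbours e D.
  rewrite (inj_hom_turan n r0) => e_irr e_sym emax turan_e.
  apply: (few_nonneighbours_of_maximal eH_irr ab e_irr e_sym emax _ few_turan) => //.
  exact: multipartite_sym.
(* Pull-backs compose, so the best pull-back of [eG] is not improved by any further one; the
   identity shows that it is at least as good as [eG]. *)
pose pullG (rho : {ffun 'I_n -> 'I_n}) := inj_hom eH (pull eG rho).
case: (@arg_maxnP _ [ffun i => i] predT pullG isT) => rho0 _ rho0_max.
pose e := pull eG rho0.
have e_irr : irreflexive e by move=> i; exact: eG_irr.
have e_sym : symmetric e by move=> i j; exact: eG_sym.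
have e_max (rho : 'I_n -> 'I_n) : inj_hom eH (pull e rho) <= inj_hom eH e.
  have := rho0_max [ffun i => rho0 (rho i)] isT; apply: leq_trans.
  apply/eq_leq/eq_inj_hom => i j; by rewrite /pull !ffunE.
have G_le_e : inj_hom eH eG <= inj_hom eH e.
  have := rho0_max [ffun i => i] isT; apply: leq_trans.
  apply/eq_leq/eq_inj_hom => i j; by rewrite /pull !ffunE.
have turan_lt_e := leq_trans lt_turan G_le_e.
have [k0 e_k0] : exists k : 'I_n -> 'I_r, e =2 multipartite k.
  apply: multipartite_of_nonadjacency_trans => //; first exact: Kfree_pull.
  have eD := few_max e e_irr e_sym e_max (ltnW turan_lt_e).
  by move=> u v w; exact: (nonadjacency_trans eH_irr eH_sym ab e_irr e_sym eD).
(* Two extremal choices: first the largest count over all colourings, then the least sum of squared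
   class sizes among colourings attaining it. *)
pose homk (k : {ffun 'I_n -> 'I_r}) := inj_hom eH (multipartite k).
case: (@arg_maxnP _ (finfun k0) predT homk isT) => k1 _ k1_max.
case: (@arg_minnP _ k1 (fun k => homk k == homk k1)
         (fun k => \sum_c class_size k c ^ 2) (eqxx _)) => k /eqP k_hom k_min.
have k_max k' : homk k' <= homk k by rewrite k_hom; exact: k1_max.
have e_le_k : inj_hom eH e <= homk k.
  apply: leq_trans (k_max (finfun k0)).
  apply/eq_leq/eq_inj_hom => i j; by rewrite e_k0 /multipartite /pull !ffunE.
have turan_lt_k := leq_trans turan_lt_e e_le_k.
(* A class consists of a vertex and its non-neighbours, so [D + 1] would do; [D + 4] is the form in
   [hD]. *)
have kD c : class_size k c <= D + 4.
  have [-> //|] := posnP (class_size k c).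
  case/card_gt0P=> v; rewrite inE => /eqP <-.
  rewrite -card_nonneighbours_multipartite.
  suff /(_ v) : few_nonneighbours (multipartite k) D by lia.
  apply: few_max (ltnW turan_lt_k);
    [exact: multipartite_irr | exact: multipartite_sym |].
  move=> rho; have := k_max [ffun i => k (rho i)]; apply: leq_trans.
  apply/eq_leq/eq_inj_hom => i j; by rewrite /multipartite /pull !ffunE.
(* A move from a class to one smaller by at least two keeps the count maximal but lowers the sum of
   squares, against the choice of [k]. *)
have k_bal : balanced k.
  move=> c d; rewrite leqNgt; apply/negP => lt_dc.
  have /card_gt0P[x] : 0 < class_size k c by lia.
  rewrite inE => /eqP kx; rewrite -kx in lt_dc.
  pose k' := finfun (recolour k x d).
  have k'E : multipartite (recolour k x d) =2 multipartite k'.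
    by move=> i j; rewrite /multipartite /pull !ffunE.
  have k'_hom : homk k' == homk k1.
    rewrite eqn_leq -k_hom k_max /= /homk -(eq_inj_hom eH k'E).
    rewrite card_ord in hD.
    apply: (inj_hom_recolour_ge eH_irr eH_sym ab _ hD kD); last exact: ltnW.
    lia.
  have := k_min _ k'_hom; apply/negP; rewrite -ltnNge.
  rewrite (eq_bigr (fun c => class_size (recolour k x d) c ^ 2)) => [|i _]; last first.
    by congr (_ ^ _); apply: eq_card => z; rewrite !inE ffunE.
  exact: sum_sqr_recolour lt_dc.
move: turan_lt_k; rewrite (inj_hom_turan n r0) /homk.
by rewrite (inj_hom_balanced eH r0 k_bal (@balanced_turan n r r0)) ltnn.
Qed.
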